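(* For $\alpha,\alpha'\in\Lambda$, the representations $\pi_\alpha$ and $\pi_{\alpha'}$ of $W$ are unitarily equivalent if and only if $\alpha\sim\alpha'$.
   Context: Fix $d\ge 2$ and complex numbers $q_{ij}$, $1\le i\ne j\le d$, with $|q_{ij}|<1$ and $q_{ij}=\overline{q_{ji}}$. Let $W$ be the universal $C^*$-algebra generated by $s_1,\dots,s_d$ subject to $s_i^*s_i=I$ and $s_i^*s_j=q_{ij}s_js_i^*$ for $i\ne j$. Let $\Lambda_m=\{1,\dots,d\}^m$ ($\Lambda_0=\{\emptyset\}$), $\Lambda^0=\bigcup_m\Lambda_m$, $\Lambda=\{1,\dots,d\}^{\mathbb N}$; $s_\alpha=s_{\alpha_1}\cdots s_{\alpha_m}$, $s_\emptyset=I$. Shifts: $\sigma(\beta_1,\beta_2,\dots)=(\beta_2,\dots)$, $\sigma_j(\beta_1,\beta_2,\dots)=(j,\beta_1,\beta_2,\dots)$. $\beta\sim\alpha$ means $\sigma^m(\beta)=\sigma^n(\alpha)$ for some $m,n\ge0$. Fock representation: $\pi_F$ on $\mathcal F$ with unit vector $\Omega$, $\pi_F(s_j)^*\Omega=0$, and $\pi_F(s_\gamma)\Omega$, $\gamma\in\Lambda^0$, spanning a dense subspace. For $\gamma,\beta\in\Lambda_m$, $q(\gamma,\beta)=\langle\pi_F(s_\gamma)^*\pi_F(s_\beta)\Omega,\Omega\rangle$; for infinite $\gamma,\beta$, $q(\gamma,\beta)=\lim_m q((\gamma_1,\dots,\gamma_m),(\beta_1,\dots,\beta_m))$. $H_\alpha$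 is the Hilbert space completion of the span of formal vectors $e_\beta$, $\beta\sim\alpha$, with respect to the positive form $(e_\beta,e_\gamma)=q(\gamma,\beta)$. The representation $\pi_\alpha$ of $W$ on $H_\alpha$ is given by $\pi_\alpha(s_j)e_\beta=e_{\sigma_j(\beta)}$, and $\pi_\alpha(s_j)^*e_\beta=0$ if $\beta$ does not contain $j$, $\pi_\alpha(s_j)^*e_\beta=q(j,\beta)e_{\beta\setminus j}$ otherwise, where for $\beta=(\beta'j\beta'')$ with $\beta'=(\beta'_1,\dots,\beta'_r)$ not containing $j$, $q(j,\beta)=q_{j\beta'_1}\cdots q_{j\beta'_r}$ and $\beta\setminus j=(\beta'\beta'')$. *)

(* Defs.v *)
From Stdlib Require Import Reals List Arith.
From Coquelicot Require Import Coquelicot.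
Import ListNotations.
Open Scope R_scope.

(* Letters are 0,...,d-1 (the paper's 1,...,d, shifted by one).
   Infinite words (elements of Lambda) are functions nat -> nat with values < d. *)
Definition word := nat -> nat.

Definition inLam (d : nat) (b : word) : Prop := forall k, (b k < d)%nat.

Definition word_equiv (b a : word) : Prop :=
  exists m n : nat, forall k, b (m + k)%nat = a (n + k)%nat.

Definition sigma_j (j : nat) (b : word) : word :=
  fun k => match k with O => j | S k' => b k' end.

Definition prefix (m : nat) (b : word) : list nat := map b (seq 0 m).

Fixpoint qjw (qq : nat -> nat -> C) (j : nat) (w : list nat) : C :=
  match w with
  | [] => RtoC 1
  | b :: w' => if Nat.eqb b j then RtoC 1 else Cmult (qq j b) (qjw qq j w')
  end.

Fixpoint delj (j : nat) (w : list nat) : list nat :=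
  match w with
  | [] => []
  | b :: w' => if Nat.eqb b j then w' else b :: delj j w'
  end.

(* q(gamma, beta) = <pi_F(s_gamma)^* pi_F(s_beta) Omega, Omega> for finite words,
   computed from the relations: s_gamma^* = s_{gamma_m}^* ... s_{gamma_1}^*,
   s_j^* s_beta Omega = q(j,beta) s_{beta\j} Omega if j in beta, 0 otherwise,
   and <Omega, Omega> = 1. *)
Fixpoint qfin (qq : nat -> nat -> C) (g b : list nat) : C :=
  match g with
  | [] => match b with [] => RtoC 1 | _ => RtoC 0 end
  | j :: g' =>
      if existsb (Nat.eqb j) b
      then Cmult (qjw qq j b) (qfin qq g' (delj j b))
      else RtoC 0
  end.

Definition Clim (u : nat -> C) : C :=
  pair (real (Lim_seq (fun n => fst (u n)))) (real (Lim_seq (fun n => snd (u n)))).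

Definition qinf (qq : nat -> nat -> C) (g b : word) : C :=
  Clim (fun m => qfin qq (prefix m g) (prefix m b)).

(* Formal finite linear combinations  sum_i c_i e_{beta_i}. *)
Definition vec := list (C * word)%type.

Definition vec_in (d : nat) (a : word) (x : vec) : Prop :=
  List.Forall (fun p => inLam d (snd p) /\ word_equiv (snd p) a) x.

Definition Csum (l : list C) : C := fold_right Cplus (RtoC 0) l.

(* (sum a_i e_{b_i}, sum c_k e_{g_k}) = sum a_i conj(c_k) (e_{b_i}, e_{g_k}),
   with (e_beta, e_gamma) = q(gamma, beta). *)
Definition ip (qq : nat -> nat -> C) (x y : vec) : C :=
  Csum (map (fun p =>
         Csum (map (fun r => Cmult (Cmult (fst p) (Cconj (fst r)))
                                   (qinf qq (snd r) (snd p))) y)) x).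

Definition nsq (qq : nat -> nat -> C) (x : vec) : R := fst (ip qq x x).

Definition vscale (c : C) (x : vec) : vec := map (fun p => pair (Cmult c (fst p)) (snd p)) x.
Definition vsub (x y : vec) : vec := x ++ vscale (RtoC (-1)) y.

(* Elements of the completion H_alpha: Cauchy sequences of vectors of the span
   of {e_beta : beta ~ alpha, beta in Lambda}, modulo null sequences. *)
Definition isH (d : nat) (qq : nat -> nat -> C) (a : word) (u : nat -> vec) : Prop :=
  (forall n, vec_in d a (u n)) /\
  (forall eps : R, 0 < eps -> exists N : nat, forall m n : nat,
      (N <= m)%nat -> (N <= n)%nat -> nsq qq (vsub (u m) (u n)) < eps).

Definition eqH (qq : nat -> nat -> C) (u v : nat -> vec) : Prop :=
  is_lim_seq (fun n => nsq qq (vsub (u n) (v n))) 0.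

Definition ipH (qq : nat -> nat -> C) (u v : nat -> vec) : C :=
  Clim (fun n => ip qq (u n) (v n)).

Definition addH (u v : nat -> vec) : nat -> vec := fun n => u n ++ v n.
Definition scaleH (c : C) (u : nat -> vec) : nat -> vec := fun n => vscale c (u n).

(* pi_alpha(s_j) e_beta = e_{sigma_j(beta)}, extended to the completion *)
Definition shiftH (j : nat) (u : nat -> vec) : nat -> vec :=
  fun n => map (fun p => pair (fst p) (sigma_j j (snd p))) (u n).

Definition unitary_intertwiner (d : nat) (qq : nat -> nat -> C) (a a' : word)
    (U : (nat -> vec) -> (nat -> vec)) : Prop :=
  (forall u, isH d qq a u -> isH d qq a' (U u)) /\
  (forall u v, isH d qq a u -> isH d qq a v -> eqH qq u v -> eqH qq (U u) (U v)) /\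
  (forall (c : C) u v, isH d qq a u -> isH d qq a v ->
      eqH qq (U (addH (scaleH c u) v)) (addH (scaleH c (U u)) (U v))) /\
  (forall u v, isH d qq a u -> isH d qq a v -> ipH qq (U u) (U v) = ipH qq u v) /\
  (forall v, isH d qq a' v -> exists u, isH d qq a u /\ eqH qq (U u) v) /\
  (forall j, (j < d)%nat -> forall u, isH d qq a u ->
      eqH qq (U (shiftH j u)) (shiftH j (U u))).

Definition unit_equiv (d : nat) (qq : nat -> nat -> C) (a a' : word) : Prop :=
  exists U, unitary_intertwiner d qq a a' U.

(* Main.v *)
(** If [alpha ~ alpha'] the two Hilbert spaces coincide.  Conversely, let [U] intertwine
    [pi_alpha] and [pi_alpha'].  Since [e_alpha = s_(alpha_1) ... s_(alpha_m) e_(sigma^m alpha)],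
    the unit vector [v := U e_alpha] is [s_(alpha_1) ... s_(alpha_m) v_m] with unit vectors [v_m].
    For [beta] not equivalent to [alpha], the vector [s_(alpha_m)^* ... s_(alpha_1)^* e_beta] is
    zero or a multiple of a unit vector [e_beta'], and the coefficient gains a factor of modulus
    at most [max |q_ij| < 1] at each of the infinitely many [k] for which [alpha_k] is not the
    first remaining letter of [beta].  Hence [v] is orthogonal to all [e_beta] with
    [beta ~ alpha'], so [v = 0] unless [alpha ~ alpha'].

    The Cauchy-Schwarz inequality used here needs positivity of [q(gamma, beta)].  On
    finite words [q] is a Hadamard product, over the pairs of occurrences of distinct letters,
    of the kernels equal to [1] when the two words order the pair in the same way and to [q_ij]
    or its conjugate otherwise; each of these is positive since [|q_ij| <= 1]. *)

Require Import Defs.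
From Stdlib Require Import Reals List Arith Lra Lia Classical FunctionalExtensionality.
From Coquelicot Require Import Coquelicot.
Import ListNotations.
Open Scope R_scope.

(** * Positive kernels *)

(** The kernel takes the word of the second vector first, in accordance with
    $(e_\beta,e_\gamma)=q(\gamma,\beta)$. The index type is arbitrary because both finite and
    infinite words occur. *)
Definition qform {W : Type} (K : W -> W -> C) (x y : list (C * W)) : C :=
  Csum (map (fun p =>
         Csum (map (fun r => Cmult (Cmult (fst p) (Cconj (fst r)))
                                   (K (snd r) (snd p))) y)) x).

Definition all_words {W : Type} (P : W -> Prop) (x : list (C * W)) : Prop :=
  List.Forall (fun p => P (snd p)) x.

Definition scale_by {W : Type} (u : W -> C) (x : list (C * W)) : list (C * W) :=
  map (fun p => (Cmult (u (snd p)) (fst p), snd p)) x.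

(** [P] confines the words, since the assumptions on [qq] concern only letters below [d]. *)
Definition psd {W : Type} (P : W -> Prop) (K : W -> W -> C) : Prop :=
  forall x, all_words P x -> 0 <= fst (qform K x x) /\ snd (qform K x x) = 0.

Lemma Csum_app (l m : list C) : Csum (l ++ m) = (Csum l + Csum m)%C.
Proof.
  induction l as [|c l IH]; simpl; [ring|]. rewrite IH. ring.
Qed.

Lemma Csum_map_ext {A : Type} (f g : A -> C) (l : list A) :
  (forall p, In p l -> f p = g p) -> Csum (map f l) = Csum (map g l).
Proof.
  intros H. rewrite (map_ext_in f g l H). reflexivity.
Qed.

Lemma Csum_map_plus {A : Type} (f g : A -> C) (l : list A) :
  Csum (map (fun p => (f p + g p)%C) l) = (Csum (map f l) + Csum (map g l))%C.
Proof.
  induction l as [|c l IH]; simpl; [ring|]. rewrite IH. ring.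
Qed.

Lemma Csum_map_mult {A : Type} (c : C) (f : A -> C) (l : list A) :
  Csum (map (fun p => (c * f p)%C) l) = (c * Csum (map f l))%C.
Proof.
  induction l as [|a l IH]; simpl; [ring|]. rewrite IH. ring.
Qed.

Lemma Csum_map_zero {A : Type} (f : A -> C) (l : list A) :
  (forall p, In p l -> f p = RtoC 0) -> Csum (map f l) = RtoC 0.
Proof.
  induction l as [|a l IH]; simpl; intros H; [reflexivity|].
  rewrite H, IH by auto. ring.
Qed.

Lemma qform_app_l {W : Type} (K : W -> W -> C) x x' y :
  qform K (x ++ x') y = (qform K x y + qform K x' y)%C.
Proof.
  unfold qform. rewrite map_app. apply Csum_app.
Qed.

Lemma qform_app_r {W : Type} (K : W -> W -> C) x y y' :
  qform K x (y ++ y') = (qform K x y + qform K x y')%C.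
Proof.
  unfold qform. rewrite <- Csum_map_plus. apply Csum_map_ext. intros p _.
  rewrite map_app. apply Csum_app.
Qed.

Lemma qform_ext {W : Type} (P : W -> Prop) (K K' : W -> W -> C) x y :
  all_words P x -> all_words P y ->
  (forall g b, P g -> P b -> K g b = K' g b) -> qform K x y = qform K' x y.
Proof.
  unfold all_words. rewrite !Forall_forall. intros Hx Hy H.
  unfold qform. apply Csum_map_ext. intros p Hp. apply Csum_map_ext. intros r Hr.
  rewrite H; auto.
Qed.

Lemma qform_zero {W : Type} (K : W -> W -> C) x y :
  (forall p r, In p x -> In r y -> K (snd r) (snd p) = RtoC 0) ->
  qform K x y = RtoC 0.
Proof.
  intros H. unfold qform. apply Csum_map_zero. intros p Hp.
  apply Csum_map_zero. intros r Hr. rewrite H by assumption. ring.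
Qed.

Lemma qform_plus {W : Type} (K K' : W -> W -> C) x y :
  qform (fun g b => K g b + K' g b)%C x y = (qform K x y + qform K' x y)%C.
Proof.
  unfold qform. rewrite <- Csum_map_plus. apply Csum_map_ext. intros p _.
  rewrite <- Csum_map_plus. apply Csum_map_ext. intros r _. ring.
Qed.

Lemma qform_scale_by {W : Type} (K : W -> W -> C) (u v : W -> C) x y :
  qform K (scale_by u x) (scale_by v y) =
  qform (fun g b => K g b * (Cconj (v g) * u b))%C x y.
Proof.
  unfold qform, scale_by. rewrite map_map. apply Csum_map_ext. intros p _.
  rewrite map_map. apply Csum_map_ext. intros r _. simpl.
  rewrite Cmult_conj. ring.
Qed.

Lemma qform_scale_l (K : word -> word -> C) c x y :
  qform K (vscale c x) y = (c * qform K x y)%C.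
Proof.
  unfold qform, vscale. rewrite map_map, <- Csum_map_mult. apply Csum_map_ext.
  intros p _. rewrite <- Csum_map_mult. apply Csum_map_ext. intros r _. simpl. ring.
Qed.

Lemma qform_scale_r (K : word -> word -> C) c x y :
  qform K x (vscale c y) = (Cconj c * qform K x y)%C.
Proof.
  unfold qform, vscale. rewrite <- Csum_map_mult. apply Csum_map_ext.
  intros p _. rewrite map_map, <- Csum_map_mult. apply Csum_map_ext.
  intros r _. simpl. rewrite Cmult_conj. ring.
Qed.

Lemma qform_map {W V : Type} (K : W -> W -> C) (f : V -> W) (x y : list (C * V)) :
  qform K (map (fun p => (fst p, f (snd p))) x) (map (fun p => (fst p, f (snd p))) y) =
  qform (fun g b => K (f g) (f b)) x y.
Proof.
  unfold qform. rewrite map_map. apply Csum_map_ext. intros p _. rewrite map_map.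
  reflexivity.
Qed.

Lemma qform_filter_l {W : Type} (K : W -> W -> C) (t : C * W -> bool) x y :
  qform K x y =
  (qform K (filter t x) y + qform K (filter (fun p => negb (t p)) x) y)%C.
Proof.
  induction x as [|p x IH]; [unfold qform; simpl; ring|].
  change (p :: x) with ([p] ++ x). rewrite qform_app_l, IH, !filter_app, !qform_app_l.
  simpl. destruct (t p); simpl; unfold qform; simpl; ring.
Qed.

Lemma qform_filter_r {W : Type} (K : W -> W -> C) (t : C * W -> bool) x y :
  qform K x y =
  (qform K x (filter t y) + qform K x (filter (fun p => negb (t p)) y))%C.
Proof.
  induction y as [|p y IH].
  - simpl. replace (qform K x []) with (RtoC 0); [ring|].
    symmetry. apply qform_zero. intros ? ? _ [].
  - change (p :: y) with ([p] ++ y).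
    rewrite qform_app_r, IH, !filter_app, !qform_app_r.
    assert (H0 : qform K x [] = RtoC 0) by (apply qform_zero; intros ? ? _ []).
    simpl. destruct (t p); simpl; rewrite H0; ring.
Qed.

(** A kernel that vanishes between the two classes of [t] is block diagonal, so positivity may be
    checked on each class separately. *)
Lemma qform_split {W : Type} (K : W -> W -> C) (t : W -> bool) x :
  (forall p r, In p x -> In r x -> t (snd r) <> t (snd p) ->
     K (snd r) (snd p) = RtoC 0) ->
  let A := filter (fun p => t (snd p)) x in
  let B := filter (fun p => negb (t (snd p))) x in
  qform K x x = (qform K A A + qform K B B)%C.
Proof.
  intros H A B.
  rewrite (qform_filter_l K (fun p => t (snd p)) x x).
  fold A B.
  rewrite (qform_filter_r K (fun p => t (snd p)) A x).
  rewrite (qform_filter_r K (fun p => t (snd p)) B x).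
  fold A B.
  rewrite (qform_zero K A B), (qform_zero K B A); [ring| |].
  - unfold A, B. intros p r Hp Hr. apply filter_In in Hp, Hr.
    destruct Hp as [Hp Hp'], Hr as [Hr Hr']. apply H; auto.
    apply Bool.negb_true_iff in Hp'. congruence.
  - unfold A, B. intros p r Hp Hr. apply filter_In in Hp, Hr.
    destruct Hp as [Hp Hp'], Hr as [Hr Hr']. apply H; auto.
    apply Bool.negb_true_iff in Hr'. congruence.
Qed.

Lemma all_words_map {W V : Type} (P : W -> Prop) (Q : V -> Prop) (f : V -> W) x :
  (forall w, Q w -> P (f w)) -> all_words Q x ->
  all_words P (map (fun p => (fst p, f (snd p))) x).
Proof.
  unfold all_words. intros H. rewrite !Forall_forall. intros Hx p Hp.
  apply in_map_iff in Hp. destruct Hp as [r [<- Hr]]. simpl. auto.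
Qed.

Lemma all_words_scale_by {W : Type} (P : W -> Prop) (u : W -> C) x :
  all_words P x -> all_words P (scale_by u x).
Proof.
  unfold all_words, scale_by. rewrite !Forall_forall. intros Hx p Hp.
  apply in_map_iff in Hp. destruct Hp as [r [<- Hr]]. simpl. auto.
Qed.

Lemma all_words_filter {W : Type} (P : W -> Prop) (t : W -> bool) x :
  all_words P x ->
  all_words (fun w => P w /\ t w = true) (filter (fun p => t (snd p)) x).
Proof.
  unfold all_words. rewrite !Forall_forall. intros Hx p Hp.
  apply filter_In in Hp. destruct Hp. auto.
Qed.

Lemma all_words_impl {W : Type} (P Q : W -> Prop) (x : list (C * W)) :
  (forall w, P w -> Q w) -> all_words P x -> all_words Q x.
Proof.
  intros H. apply Forall_impl. auto.
Qed.

Lemma all_words_app {W : Type} (P : W -> Prop) (x y : list (C * W)) :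
  all_words P x -> all_words P y -> all_words P (x ++ y).
Proof.
  intros Hx Hy. apply Forall_app. split; assumption.
Qed.

Lemma psd_ext {W : Type} (P : W -> Prop) (K K' : W -> W -> C) :
  (forall g b, P g -> P b -> K g b = K' g b) -> psd P K -> psd P K'.
Proof.
  intros H HK x Hx. rewrite <- (qform_ext P K K' x x Hx Hx H). auto.
Qed.

Lemma psd_comap {W V : Type} (P : W -> Prop) (Q : V -> Prop) (f : V -> W) K :
  (forall w, Q w -> P (f w)) -> psd P K -> psd Q (fun g b => K (f g) (f b)).
Proof.
  intros H HK x Hx. rewrite <- qform_map. apply HK.
  apply all_words_map with Q; assumption.
Qed.

(** * Two-point kernels and Hadamard products *)

Definition k2 (q : C) (s t : bool) : C :=
  match s, t with
  | false, true => q
  | true, false => Cconj q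
  | _, _ => RtoC 1
  end.

(* [k2 q] is the Gram matrix of the vectors [(1, 0)] and [(q, sqrt (1 - |q|^2))]. *)
Lemma k2_gram (q : C) : Cmod q <= 1 ->
  let u t := if t : bool then q else RtoC 1 in
  let v t := if t : bool then RtoC (sqrt (1 - Cmod q ^ 2)) else RtoC 0 in
  forall s t, k2 q s t = (Cconj (u s) * u t + Cconj (v s) * v t)%C.
Proof.
  intros Hq u v s t.
  assert (Hs : sqrt (1 - Cmod q ^ 2) * sqrt (1 - Cmod q ^ 2) = 1 - Cmod q ^ 2).
  { apply sqrt_sqrt. pose proof (Cmod_ge_0 q). nra. }
  pose proof (Cmod2_alt q) as Hm. unfold Re, Im in Hm.
  destruct s, t; unfold u, v; simpl k2; apply injective_projections; simpl in *; lra.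
Qed.

(** Multiplying a kernel by $\overline{u(g)}u(b)$ only rescales the coefficients of the vector. By
    [k2_gram] the new form is thus a sum of two values of the form of [K]. *)
Lemma psd_mult_k2 {W : Type} (P : W -> Prop) (K : W -> W -> C) (q : C) (f : W -> bool) :
  Cmod q <= 1 -> psd P K -> psd P (fun g b => K g b * k2 q (f g) (f b))%C.
Proof.
  intros Hq HK x Hx.
  pose proof (k2_gram q Hq) as G. cbv zeta in G.
  set (u := fun t : bool => if t then q else RtoC 1) in *.
  set (v := fun t : bool => if t then RtoC (sqrt (1 - Cmod q ^ 2)) else RtoC 0) in *.
  replace (qform (fun g b => K g b * k2 q (f g) (f b))%C x x) with
    (qform K (scale_by (fun w => u (f w)) x) (scale_by (fun w => u (f w)) x) +
     qform K (scale_by (fun w => v (f w)) x) (scale_by (fun w => v (f w)) x))%C.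
  - destruct (HK _ (all_words_scale_by P (fun w => u (f w)) x Hx)).
    destruct (HK _ (all_words_scale_by P (fun w => v (f w)) x Hx)).
    simpl. split; lra.
  - rewrite !qform_scale_by, <- qform_plus. apply (qform_ext P); auto.
    intros g b _ _. rewrite G. unfold u, v. ring.
Qed.

(** * Hermitian symmetry and the Cauchy-Schwarz inequality *)

(** Polarization: the form is real at $x+y$ and at $x+iy$, which settles the imaginary and the real
    part respectively. *)
Lemma psd_hermitian (P : word -> Prop) K x y :
  psd P K -> all_words P x -> all_words P y -> qform K y x = Cconj (qform K x y).
Proof.
  intros HK Hx Hy.
  assert (Hs : forall c, all_words P (vscale c y)).
  { intros c. apply (all_words_scale_by P (fun _ => c) y Hy). }
  destruct (HK x Hx) as [_ Ix]. destruct (HK y Hy) as [_ Iy].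
  destruct (HK (x ++ y)) as [_ I1].
  { apply all_words_app; auto. }
  destruct (HK (x ++ vscale Ci y)) as [_ I2].
  { apply all_words_app; auto. }
  rewrite !qform_app_l, !qform_app_r in I1.
  rewrite !qform_app_l, !qform_app_r, !qform_scale_l, !qform_scale_r in I2.
  destruct (qform K x x), (qform K y y), (qform K x y), (qform K y x).
  simpl in *. apply injective_projections; simpl; lra.
Qed.

Lemma cauchy_schwarz (P : word -> Prop) K x y :
  psd P K -> all_words P x -> all_words P y ->
  Cmod (qform K x y) ^ 2 <= fst (qform K x x) * fst (qform K y y).
Proof.
  intros HK Hx Hy.
  assert (Hs : forall c, all_words P (vscale c y)).
  { intros c. apply (all_words_scale_by P (fun _ => c) y Hy). }
  pose proof (psd_hermitian P K x y HK Hx Hy) as Hh.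
  destruct (HK x Hx) as [Px Ix]. destruct (HK y Hy) as [Py Iy].
  (* Positivity at $x-t\langle x,y\rangle y$ for real $t$. *)
  assert (Q : forall t, 0 <= fst (qform K x x) - 2 * t * Cmod (qform K x y) ^ 2
              + t ^ 2 * Cmod (qform K x y) ^ 2 * fst (qform K y y)).
  { intros t.
    destruct (HK (x ++ vscale (RtoC (- t) * qform K x y)%C y)) as [H _].
    { apply all_words_app; auto. }
    rewrite !qform_app_l, !qform_app_r, !qform_scale_l, !qform_scale_r in H.
    rewrite Hh in H. rewrite Cmod2_alt. unfold Re, Im.
    destruct (qform K x x), (qform K y y), (qform K x y).
    simpl in *. subst. eapply Rle_trans; [exact H|]. apply Req_le. ring. }
  set (A := fst (qform K x x)) in *. set (B := fst (qform K y y)) in *.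
  set (z := Cmod (qform K x y) ^ 2) in *.
  assert (Hz : 0 <= z) by apply pow2_ge_0.
  destruct (Rle_lt_or_eq_dec 0 B Py) as [HB|HB].
  (* The value $t=1/B$ minimizes the quadratic when $z>0$. *)
  - specialize (Q (/ B)).
    assert (E : A - 2 * / B * z + (/ B) ^ 2 * z * B = A - z / B) by (field; lra).
    rewrite E in Q. assert (z / B <= A) by lra.
    apply Rmult_le_compat_r with (r := B) in H; [|lra].
    unfold Rdiv in H. rewrite Rmult_assoc, Rinv_l, Rmult_1_r in H; lra.
  (* With $B=0$ the bound is affine in $t$; if $z>0$, the chosen $t$ makes it $-1$. *)
  - rewrite <- HB in *. destruct (Rle_lt_or_eq_dec 0 z Hz) as [Hz'|Hz']; [|lra].
    specialize (Q ((A + 1) / (2 * z))).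
    assert (E : 2 * ((A + 1) / (2 * z)) * z = A + 1) by (field; lra).
    rewrite E in Q. lra.
Qed.

(** * Positivity on finite words *)

Definition q_bounded (d : nat) (qq : nat -> nat -> C) (Q : R) : Prop :=
  forall i j, (i < d)%nat -> (j < d)%nat -> i <> j -> Cmod (qq i j) <= Q.

Definition q_hermitian (d : nat) (qq : nat -> nat -> C) : Prop :=
  forall i j, (i < d)%nat -> (j < d)%nat -> i <> j -> qq i j = Cconj (qq j i).

Lemma existsb_eqb_In (j : nat) (w : list nat) :
  existsb (Nat.eqb j) w = true <-> In j w.
Proof.
  rewrite existsb_exists. split.
  - intros [x [Hx E]]. apply Nat.eqb_eq in E. subst. assumption.
  - intros H. exists j. split; [assumption|apply Nat.eqb_refl].
Qed.

Lemma qfin_cons_in qq j g b :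
  In j b -> qfin qq (j :: g) b = (qjw qq j b * qfin qq g (delj j b))%C.
Proof.
  intros H. simpl. rewrite (proj2 (existsb_eqb_In j b) H). reflexivity.
Qed.

Lemma qfin_cons_notin qq j g b : ~ In j b -> qfin qq (j :: g) b = RtoC 0.
Proof.
  intros H. simpl. destruct (existsb (Nat.eqb j) b) eqn:E; [|reflexivity].
  apply existsb_eqb_In in E. contradiction.
Qed.

Lemma in_delj_neq i j w : i <> j -> In i (delj j w) <-> In i w.
Proof.
  intros H. induction w as [|b w IH]; simpl; [tauto|].
  destruct (Nat.eqb_spec b j); simpl; [|rewrite IH; tauto].
  split; [tauto|]. intros [E|E]; [congruence|assumption].
Qed.

Lemma in_delj i j w : In i (delj j w) -> In i w.
Proof.
  induction w as [|b w IH]; simpl; [tauto|].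
  destruct (Nat.eqb_spec b j); simpl; tauto.
Qed.

Lemma delj_comm i j w : delj i (delj j w) = delj j (delj i w).
Proof.
  destruct (Nat.eq_dec i j) as [->|Hij]; [reflexivity|].
  induction w as [|b w IH]; simpl; [reflexivity|].
  destruct (Nat.eqb b j) eqn:Ej, (Nat.eqb b i) eqn:Ei; simpl; rewrite ?Ej, ?Ei.
  - apply Nat.eqb_eq in Ej, Ei. congruence.
  - reflexivity.
  - reflexivity.
  - rewrite IH. reflexivity.
Qed.

Lemma length_delj j w : In j w -> length w = S (length (delj j w)).
Proof.
  induction w as [|b w IH]; simpl; [tauto|]. intros H.
  destruct (Nat.eqb_spec b j); [reflexivity|].
  simpl. rewrite IH; [reflexivity|]. destruct H; [contradiction|assumption].
Qed.

Lemma qfin_in_notin qq j g b : In j g -> ~ In j b -> qfin qq g b = RtoC 0.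
Proof.
  revert b. induction g as [|i g IH]; intros b Hg Hb; [destruct Hg|].
  destruct (in_dec Nat.eq_dec i b) as [Hi|Hi]; [|apply qfin_cons_notin, Hi].
  rewrite qfin_cons_in by assumption.
  destruct Hg as [->|Hg]; [contradiction|].
  rewrite IH; [ring|assumption|]. intros H. apply Hb, (in_delj _ _ _ H).
Qed.

(** The letter [j] is never removed from [b], so the recursion either meets an absent letter or ends
    with the empty word against a nonempty one. *)
Lemma qfin_notin_in qq j g b : ~ In j g -> In j b -> qfin qq g b = RtoC 0.
Proof.
  revert b. induction g as [|i g IH]; intros b Hg Hb.
  - destruct b; [destruct Hb|reflexivity].
  - destruct (in_dec Nat.eq_dec i b) as [Hi|Hi]; [|apply qfin_cons_notin, Hi].
    simpl in Hg. rewrite qfin_cons_in by assumption.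
    rewrite IH; [ring|tauto|]. apply in_delj_neq; [|assumption].
    intros E. apply Hg. left. congruence.
Qed.

(** * Letters preceding the first occurrence of a given letter *)

(** The number of letters [i] before the first [j], or in all of [w] if [j] is absent; it is zero
    for [i = j]. *)
Fixpoint cnt (j i : nat) (w : list nat) : nat :=
  match w with
  | [] => 0
  | b :: w' => if Nat.eqb b j then 0%nat
               else if Nat.eqb b i then S (cnt j i w') else cnt j i w'
  end.

(* [q ^ (n - m)] if [m <= n], and [(Cconj q) ^ (m - n)] otherwise. *)
Fixpoint kap (q : C) (m n : nat) : C :=
  match m with
  | O => Cpow q n
  | S m' => match n with
            | O => Cmult (Cconj q) (kap q m' O)
            | S n' => kap q m' n'
            end
  end.

Fixpoint kprod (qq : nat -> nat -> C) (j d : nat) (f g : nat -> nat) : C :=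
  match d with
  | O => RtoC 1
  | S i => Cmult (kap (qq j i) (f i) (g i)) (kprod qq j i f g)
  end.

Lemma kprod_ext qq j d f g f' g' :
  (forall i, (i < d)%nat -> f i = f' i /\ g i = g' i) ->
  kprod qq j d f g = kprod qq j d f' g'.
Proof.
  induction d as [|d IH]; intros H; simpl; [reflexivity|].
  destruct (H d) as [-> ->]; [lia|]. rewrite IH; [reflexivity|]. intros; apply H; lia.
Qed.

Lemma kprod_update qq j d i c f g f' g' :
  (i < d)%nat ->
  (forall k, k <> i -> f k = f' k /\ g k = g' k) ->
  kap (qq j i) (f i) (g i) = Cmult c (kap (qq j i) (f' i) (g' i)) ->
  kprod qq j d f g = Cmult c (kprod qq j d f' g').
Proof.
  intros Hi He Hc. induction d as [|d IH]; [lia|]. simpl.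
  destruct (Nat.eq_dec d i) as [->|Hd].
  - rewrite Hc, (kprod_ext qq j i f g f' g'); [ring|].
    intros k Hk. apply He. lia.
  - rewrite IH by lia. destruct (He d Hd) as [-> ->]. ring.
Qed.

Lemma kprod_zero qq j d f g :
  (forall i, f i = O) -> (forall i, g i = O) -> kprod qq j d f g = RtoC 1.
Proof.
  intros Hf Hg. induction d as [|d IH]; simpl; [reflexivity|].
  rewrite IH, Hf, Hg. simpl. ring.
Qed.

Lemma cnt_self j w : cnt j j w = O.
Proof.
  induction w as [|b w IH]; simpl; [reflexivity|]. destruct (Nat.eqb b j); auto.
Qed.

Lemma cnt_le_length j i w : (cnt j i w <= length w)%nat.
Proof.
  induction w as [|b w IH]; simpl; [lia|].
  destruct (Nat.eqb b j), (Nat.eqb b i); lia.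
Qed.

(** Groups the factors of $q(j,b)$ by letter: each [i] before the first [j] contributes $q_{ji}$.
    The zero counts belong to a word that starts with [j]. *)
Lemma qjw_kprod qq d j b :
  List.Forall (fun k => (k < d)%nat) b ->
  qjw qq j b = kprod qq j d (fun _ => O) (fun i => cnt j i b).
Proof.
  induction 1 as [|k b Hk _ IH]; simpl.
  - rewrite kprod_zero; auto.
  - destruct (Nat.eqb_spec k j) as [E|E].
    + rewrite kprod_zero; auto.
    + rewrite (kprod_update qq j d k (qq j k) _ _ (fun _ => O) (fun i => cnt j i b));
        [rewrite IH; reflexivity|assumption| |].
      * intros l Hl. destruct (Nat.eqb_spec k l); [congruence|auto].
      * rewrite Nat.eqb_refl. reflexivity.
Qed.

(** The two cases are [i] first and [j] first. In the former, the first [j] does not enter $q(i,b)$,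
    and removing [i] lowers its count by one. In the latter, that [j] contributes $q_{ij}$ and no
    [i] is counted. *)
Lemma first_of_two qq i j b : i <> j -> In i b -> In j b ->
  (qjw qq i b = qjw qq i (delj j b) /\
   (forall k, cnt j k b = if Nat.eqb i k then S (cnt j k (delj i b))
                          else cnt j k (delj i b))) \/
  (qjw qq i b = Cmult (qq i j) (qjw qq i (delj j b)) /\ cnt j i b = O /\
   (forall k, cnt j k b = cnt j k (delj i b))).
Proof.
  intros Hij. induction b as [|c b IH]; intros Hi Hj; [destruct Hi|].
  simpl. destruct (Nat.eqb_spec c i) as [Ei|Ei].
  - subst c. left. destruct (Nat.eqb_spec i j); [contradiction|].
    simpl. rewrite Nat.eqb_refl. auto.
  - destruct (Nat.eqb_spec c j) as [Ej|Ej].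
    + subst c. right. simpl. rewrite Nat.eqb_refl. auto.
    + destruct Hi as [Hi|Hi]; [congruence|]. destruct Hj as [Hj|Hj]; [congruence|].
      simpl. destruct (Nat.eqb_spec c i); [contradiction|].
      destruct (Nat.eqb_spec c j); [contradiction|].
      destruct (IH Hi Hj) as [[H1 H2]|[H1 [H2 H3]]].
      * left. split; [rewrite H1; reflexivity|]. intros k. rewrite H2.
        destruct (Nat.eqb i k), (Nat.eqb c k); reflexivity.
      * right. split; [rewrite H1; ring|]. split; [assumption|].
        intros k. rewrite H3. reflexivity.
Qed.

Lemma Forall_delj (P : nat -> Prop) j w : List.Forall P w -> List.Forall P (delj j w).
Proof.
  rewrite !Forall_forall. intros H x Hx. apply H, (in_delj _ _ _ Hx).
Qed.

(* Removing the first [j] from both words only uncouples the pairs formed by that [j]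
   and the other letters, so unlike its definition [qfin] has a symmetric recursion. *)
Lemma qfin_delj_both qq d j g b :
  q_hermitian d qq ->
  List.Forall (fun k => (k < d)%nat) g -> List.Forall (fun k => (k < d)%nat) b ->
  In j g -> In j b ->
  qfin qq g b =
  (qfin qq (delj j g) (delj j b) *
   kprod qq j d (fun i => cnt j i g) (fun i => cnt j i b))%C.
Proof.
  intros Hh Hg. revert b. induction Hg as [|i g Hi Hg IH]; intros b Hb Jg Jb; [destruct Jg|].
  destruct (Nat.eq_dec i j) as [->|Hij].
  - rewrite qfin_cons_in by assumption. simpl delj. rewrite Nat.eqb_refl.
    rewrite (qjw_kprod qq d) by assumption.
    rewrite (kprod_ext qq j d (fun i => cnt j i (j :: g)) _ (fun _ => O) (fun i => cnt j i b)).
    + ring.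
    + intros k _. simpl. rewrite Nat.eqb_refl. auto.
  - destruct Jg as [Jg|Jg]; [contradiction|].
    assert (Hd : delj j (i :: g) = i :: delj j g).
    { simpl. destruct (Nat.eqb_spec i j); [contradiction|reflexivity]. }
    rewrite Hd.
    destruct (in_dec Nat.eq_dec i b) as [Ib|Ib].
    2:{ rewrite !qfin_cons_notin; [ring|rewrite in_delj_neq by assumption|]; assumption. }
    rewrite !qfin_cons_in by (rewrite ?in_delj_neq by assumption; assumption).
    rewrite IH; [|apply Forall_delj, Hb|assumption|
      apply in_delj_neq; [congruence|assumption]].
    rewrite (delj_comm i j b).
    assert (Hc : forall k, cnt j k (i :: g) = if Nat.eqb i k then S (cnt j k g) else cnt j k g).
    { intros k. simpl. destruct (Nat.eqb_spec i j); [contradiction|reflexivity]. }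
    assert (Hjd : (j < d)%nat) by (rewrite Forall_forall in Hb; auto).
    destruct (first_of_two qq i j b Hij Ib Jb) as [[H1 H2]|[H1 [H2 H3]]].
    (* In both words this [i] precedes the first [j]: both counts drop by one, which leaves [kap]
       unchanged. *)
    + rewrite H1.
      rewrite (kprod_update qq j d i (RtoC 1) (fun k => cnt j k (i :: g)) _
                 (fun k => cnt j k g) (fun k => cnt j k (delj i b))); [ring|assumption| |].
      * intros k Hk. rewrite Hc, H2. destruct (Nat.eqb_spec i k); [congruence|auto].
      * rewrite Hc, H2, Nat.eqb_refl. simpl. ring.
    (* The words disagree on the order of [i] and [j], and the factor $q_{ij}=\overline{q_{ji}}$ is
       the one that [kap] has when only its first count is positive. *)
    + rewrite H1.
      rewrite (kprod_update qq j d i (qq i j) (fun k => cnt j k (i :: g)) _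
                 (fun k => cnt j k g) (fun k => cnt j k (delj i b))); [ring|assumption| |].
      * intros k Hk. rewrite Hc, H3. destruct (Nat.eqb_spec i k); [congruence|auto].
      * rewrite Hc, <- H3, H2, Nat.eqb_refl. rewrite (Hh i j) by auto. reflexivity.
Qed.

(** * Positivity of the kernel on words of fixed length *)

(** [kap q m n] is the product over $s\ge 0$ of the two-point kernels at the truth values of $s<m$
    and $s<n$. The induction peels off the factor $s=0$. *)
Lemma psd_mult_kap {W : Type} (m : nat) (P : W -> Prop) (K : W -> W -> C) q (N : W -> nat) :
  (forall w, P w -> (N w <= m)%nat) ->
  Cmod q <= 1 -> psd P K -> psd P (fun g b => K g b * kap q (N g) (N b))%C.
Proof.
  revert N. induction m as [|m IH]; intros N HN Hq HK.
  - apply psd_ext with K; [|assumption]. intros g b Hg Hb.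
    replace (N g) with O by (specialize (HN g Hg); lia).
    replace (N b) with O by (specialize (HN b Hb); lia). simpl. ring.
  - apply psd_ext with (fun g b => (K g b * kap q (pred (N g)) (pred (N b)))
                                 * k2 q (Nat.ltb 0 (N g)) (Nat.ltb 0 (N b)))%C.
    + intros g b _ _. destruct (N g), (N b); simpl; ring.
    + apply psd_mult_k2; [assumption|].
      apply (IH (fun w => pred (N w))); [|assumption|assumption].
      intros w Hw. specialize (HN w Hw). lia.
Qed.

Lemma psd_mult_kprod {W : Type} qq d j l m (P : W -> Prop) (K : W -> W -> C)
    (N : W -> nat -> nat) :
  q_bounded d qq 1 -> (j < d)%nat -> (l <= d)%nat ->
  (forall w i, P w -> (N w i <= m)%nat) -> (forall w, P w -> N w j = O) ->
  psd P K -> psd P (fun g b => K g b * kprod qq j l (N g) (N b))%C.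
Proof.
  intros Hq Hj Hl HN Hz HK. induction l as [|l IH].
  - apply psd_ext with K; [|assumption]. intros. simpl. ring.
  - assert (Hl' : (l <= d)%nat) by lia. specialize (IH Hl').
    (* The factor of [j] itself is 1 because its counts vanish; the diagonal entry [qq j j] is
       unconstrained. *)
    destruct (Nat.eq_dec l j) as [->|Hlj].
    + apply psd_ext with (fun g b => K g b * kprod qq j j (N g) (N b))%C; [|assumption].
      intros g b Hg Hb. simpl. rewrite !Hz by assumption. simpl. ring.
    + apply psd_ext with (fun g b => (K g b * kprod qq j l (N g) (N b))
                                   * kap (qq j l) (N g l) (N b l))%C.
      * intros. simpl. ring.
      * apply (psd_mult_kap m P _ (qq j l) (fun w => N w l)); auto.
Qed.

(** Induction on the length [m], and inside it on the number [k] of admissible letters. Words with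
    and without the least letter [l] are orthogonal. On the former, removing the first [l] shortens
    the words and leaves a positive factor [kprod]; the latter use one letter less. *)
Lemma psd_qfin_from qq d m k l :
  q_bounded d qq 1 -> q_hermitian d qq -> (d = l + k)%nat ->
  psd (fun w => length w = m /\ List.Forall (fun b => (l <= b < d)%nat) w) (qfin qq).
Proof.
  intros Hq Hh. revert k l. induction m as [|m IHm].
  - intros k l _ x Hx. rewrite (qform_ext _ _ (fun _ _ => RtoC 1) x x Hx Hx).
    2:{ intros g b [Hg _] [Hb _]. apply length_zero_iff_nil in Hg, Hb. subst. reflexivity. }
    (* For the constant kernel 1 the form is the squared modulus of the sum of the coefficients. *)
    assert (E : qform (fun _ _ : list nat => RtoC 1) x x =
                (Csum (map fst x) * Cconj (Csum (map fst x)))%C).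
    { unfold qform. rewrite (Cmult_comm (Csum (map fst x))).
      rewrite <- Csum_map_mult. apply Csum_map_ext. intros p _.
      rewrite Cmult_comm.
      assert (Ec : Cconj (Csum (map fst x)) = Csum (map (fun r => Cconj (fst r)) x)).
      { clear Hx. induction x as [|r x IHx]; simpl.
        - apply injective_projections; simpl; ring.
        - rewrite Cplus_conj, IHx. reflexivity. }
      rewrite Ec, <- Csum_map_mult. apply Csum_map_ext. intros r _. ring. }
    rewrite E. destruct (Csum (map fst x)) as [r s]. simpl. split; nra.
  - induction k as [|k IHk]; intros l Hl x Hx.
    (* No letter is available, so there is no word of positive length. *)
    + destruct x as [|[c w] x]; [unfold qform; simpl; lra|].
      inversion Hx as [|? ? [Hw Hw'] _]. simpl in *.
      destruct w as [|b w]; [discriminate|]. inversion Hw'. lia.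
    + set (t := fun w => existsb (Nat.eqb l) w).
      rewrite (qform_split (qfin qq) t x).
      2:{ intros p r _ _ Ht. unfold t in Ht.
          destruct (existsb (Nat.eqb l) (snd r)) eqn:Er.
          - apply (qfin_in_notin qq l); [apply existsb_eqb_In, Er|].
            rewrite <- existsb_eqb_In. congruence.
          - apply (qfin_notin_in qq l).
            + rewrite <- existsb_eqb_In. congruence.
            + apply existsb_eqb_In. destruct (existsb (Nat.eqb l) (snd p)); congruence. }
      set (A := filter (fun p => t (snd p)) x).
      set (B := filter (fun p => negb (t (snd p))) x).
      assert (PA : 0 <= fst (qform (qfin qq) A A) /\ snd (qform (qfin qq) A A) = 0).
      { pose proof (all_words_filter _ t x Hx) as HA. fold A in HA.
        revert HA. generalize A.
        match goal with |- forall l, all_words ?P l -> _ => change (psd P (qfin qq)) end.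
        apply psd_ext with (fun g b => qfin qq (delj l g) (delj l b) *
           kprod qq l d (fun i => cnt l i g) (fun i => cnt l i b))%C.
        - intros g b [[_ Hg] Tg] [[_ Hb] Tb]. symmetry.
          apply qfin_delj_both; try assumption; try (apply existsb_eqb_In; assumption).
          + eapply Forall_impl; [|exact Hg]. simpl. intros; lia.
          + eapply Forall_impl; [|exact Hb]. simpl. intros; lia.
        - apply (psd_mult_kprod qq d l d (S m) _
                   (fun g b => qfin qq (delj l g) (delj l b)) (fun w i => cnt l i w));
            try assumption; try lia.
          + intros w i [[Hw _] _]. pose proof (cnt_le_length l i w). lia.
          + intros w _. apply cnt_self.
          + eapply psd_comap; [|exact (IHm (S k) l Hl)].
            intros w [[Hw Hw'] Tw]. split; [|apply Forall_delj, Hw'].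
            apply existsb_eqb_In, length_delj in Tw. lia. }
      assert (PB : 0 <= fst (qform (qfin qq) B B) /\ snd (qform (qfin qq) B B) = 0).
      { apply (IHk (S l)); [lia|].
        eapply all_words_impl; [|exact (all_words_filter _ (fun w => negb (t w)) x Hx)].
        intros w [[Hw Hw'] Tw]. split; [assumption|].
        rewrite Forall_forall in *. intros b Hb. specialize (Hw' b Hb).
        assert (b <> l); [|lia]. intros ->. apply existsb_eqb_In in Hb.
        unfold t in Tw. rewrite Hb in Tw. discriminate. }
      simpl. lra.
Qed.

Lemma psd_qfin qq d m :
  q_bounded d qq 1 -> q_hermitian d qq ->
  psd (fun w => length w = m /\ List.Forall (fun b => (b < d)%nat) w) (qfin qq).
Proof.
  intros Hq Hh x Hx. apply (psd_qfin_from qq d m d 0 Hq Hh eq_refl).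
  eapply all_words_impl; [|exact Hx]. intros w [H1 H2]. split; [assumption|].
  eapply Forall_impl; [|exact H2]. simpl. intros; lia.
Qed.

(** * Infinite words *)

Definition wtail (b : word) : word := fun k => b (S k).

(** Deletion is by position, as a search for a letter in an infinite word need not end; together
    with [first_at j b r] this is $b\setminus j$. *)
Definition wdel (r : nat) (b : word) : word :=
  fun k => if Nat.ltb k r then b k else b (S k).

Definition first_at (j : nat) (b : word) (r : nat) : Prop :=
  b r = j /\ forall k, (k < r)%nat -> b k <> j.

Lemma first_at_exists j b r : b r = j -> exists r', first_at j b r'.
Proof.
  induction r as [r IH] using lt_wf_ind. intros H.
  destruct (classic (exists k, (k < r)%nat /\ b k = j)) as [[k [Hk E]]|Hn].
  - exact (IH k Hk E).
  - exists r. split; [assumption|]. intros k Hk E. apply Hn. eauto.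
Qed.

Lemma inLam_wtail d b : inLam d b -> inLam d (wtail b).
Proof.
  intros H k. apply H.
Qed.

Lemma inLam_wdel d r b : inLam d b -> inLam d (wdel r b).
Proof.
  intros H k. unfold wdel. destruct (Nat.ltb k r); apply H.
Qed.

Lemma prefix_S m b : prefix (S m) b = b O :: prefix m (wtail b).
Proof.
  unfold prefix, wtail. simpl. rewrite <- seq_shift, map_map. reflexivity.
Qed.

Lemma in_prefix j m b : In j (prefix m b) <-> exists k, (k < m)%nat /\ b k = j.
Proof.
  unfold prefix. rewrite in_map_iff. split.
  - intros [k [E Hk]]. apply in_seq in Hk. exists k. split; [lia|assumption].
  - intros [k [Hk E]]. exists k. split; [assumption|]. apply in_seq. lia.
Qed.

Lemma prefix_lt d m b : inLam d b -> List.Forall (fun k => (k < d)%nat) (prefix m b).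
Proof.
  intros H. apply Forall_forall. intros k Hk. apply in_prefix in Hk.
  destruct Hk as [i [_ <-]]. apply H.
Qed.

Lemma delj_prefix j r b m : first_at j b r -> (r <= m)%nat ->
  delj j (prefix (S m) b) = prefix m (wdel r b).
Proof.
  revert b m. induction r as [|r IH]; intros b m [E Hn] Hm; rewrite prefix_S; simpl.
  - rewrite E, Nat.eqb_refl. reflexivity.
  - destruct (Nat.eqb_spec (b O) j) as [E0|_]; [destruct (Hn O); [lia|assumption]|].
    destruct m as [|m]; [lia|]. rewrite IH, prefix_S; [reflexivity| |lia].
    split; [exact E|]. intros k Hk. apply Hn. lia.
Qed.

Lemma qjw_prefix qq j r b m : first_at j b r -> (r <= m)%nat ->
  qjw qq j (prefix (S m) b) = qjw qq j (prefix r b).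
Proof.
  revert b m. induction r as [|r IH]; intros b m [E Hn] Hm.
  - rewrite prefix_S. simpl. rewrite E, Nat.eqb_refl. reflexivity.
  - destruct m as [|m]; [lia|]. rewrite (prefix_S (S m)), (prefix_S r).
    cbn [qjw]. rewrite IH; [reflexivity| |lia].
    split; [exact E|]. intros k Hk. apply Hn. lia.
Qed.

(** Once the prefix reaches the first [g O], the coefficient no longer depends on [m], and the
    remaining words again have equal length. *)
Lemma qfin_prefix_step qq g b r m : first_at (g O) b r -> (r <= m)%nat ->
  qfin qq (prefix (S m) g) (prefix (S m) b) =
  (qjw qq (g O) (prefix r b) * qfin qq (prefix m (wtail g)) (prefix m (wdel r b)))%C.
Proof.
  intros H Hm. rewrite (prefix_S m g), qfin_cons_in.
  - rewrite (qjw_prefix qq (g O) r), (delj_prefix (g O) r) by assumption. reflexivity.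
  - apply in_prefix. exists r. split; [lia|apply H].
Qed.

Lemma qfin_prefix_absent qq g b m : (forall r, b r <> g O) ->
  qfin qq (prefix (S m) g) (prefix (S m) b) = RtoC 0.
Proof.
  intros H. rewrite (prefix_S m g). apply qfin_cons_notin.
  rewrite in_prefix. intros [k [_ E]]. exact (H k E).
Qed.

Lemma qfin_refl qq w : qfin qq w w = RtoC 1.
Proof.
  induction w as [|j w IH]; [reflexivity|].
  rewrite qfin_cons_in by (left; reflexivity). simpl. rewrite Nat.eqb_refl, IH. ring.
Qed.

Lemma Cmod_qjw_le qq d Q j w : 0 <= Q <= 1 -> q_bounded d qq Q -> (j < d)%nat ->
  List.Forall (fun k => (k < d)%nat) w -> Cmod (qjw qq j w) <= 1.
Proof.
  intros HQ Hq Hj. induction 1 as [|k w Hk Hw IH]; simpl; [rewrite Cmod_1; lra|].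
  destruct (Nat.eqb_spec k j) as [E|E]; [rewrite Cmod_1; lra|].
  rewrite Cmod_mult. assert (Cmod (qq j k) <= Q) by (apply Hq; auto).
  pose proof (Cmod_ge_0 (qq j k)). pose proof (Cmod_ge_0 (qjw qq j w)). nra.
Qed.

(** The letter [b O] differs from [j], so its factor has modulus at most [Q]; all others are at most
    1. *)
Lemma Cmod_qjw_prefix_lt qq d Q j r b : 0 <= Q <= 1 -> q_bounded d qq Q ->
  (j < d)%nat -> inLam d b -> first_at j b r -> b O <> j ->
  Cmod (qjw qq j (prefix r b)) <= Q.
Proof.
  intros HQ Hq Hj Hb [Hr _] H0. destruct r as [|r]; [contradiction|].
  rewrite prefix_S. simpl. destruct (Nat.eqb_spec (b O) j) as [E|E]; [contradiction|].
  rewrite Cmod_mult. assert (Cmod (qq j (b O)) <= Q) by (apply Hq; auto).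
  assert (Cmod (qjw qq j (prefix r (wtail b))) <= 1).
  { apply (Cmod_qjw_le qq d Q); auto. apply prefix_lt, inLam_wtail, Hb. }
  pose proof (Cmod_ge_0 (qq j (b O))).
  pose proof (Cmod_ge_0 (qjw qq j (prefix r (wtail b)))). nra.
Qed.

Lemma Cmod_qfin_le qq d Q g b : 0 <= Q <= 1 -> q_bounded d qq Q ->
  List.Forall (fun k => (k < d)%nat) g -> List.Forall (fun k => (k < d)%nat) b ->
  Cmod (qfin qq g b) <= 1.
Proof.
  intros HQ Hq Hg. revert b. induction Hg as [|j g Hj _ IH]; intros b Hb.
  - destruct b; simpl; [rewrite Cmod_1|rewrite Cmod_0]; lra.
  - destruct (in_dec Nat.eq_dec j b) as [Ij|Ij].
    + rewrite qfin_cons_in, Cmod_mult by assumption.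
      pose proof (Cmod_qjw_le qq d Q j b HQ Hq Hj Hb).
      pose proof (IH (delj j b) (Forall_delj _ _ _ Hb)).
      pose proof (Cmod_ge_0 (qjw qq j b)). pose proof (Cmod_ge_0 (qfin qq g (delj j b))).
      nra.
    + rewrite qfin_cons_notin, Cmod_0 by assumption. lra.
Qed.

(* Every mismatch between [g] and [b] costs a factor [Q]; with finitely many mismatches
   the words end up equal and the sequence becomes stationary. *)
Lemma qfin_prefix_dichotomy qq d Q : 0 <= Q <= 1 -> q_bounded d qq Q ->
  forall N g b, inLam d g -> inLam d b ->
  (exists c M, forall m, (M <= m)%nat -> qfin qq (prefix m g) (prefix m b) = c) \/
  (exists M, forall m, (M <= m)%nat -> Cmod (qfin qq (prefix m g) (prefix m b)) <= Q ^ N).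
Proof.
  intros HQ Hq. induction N as [|N IHN]; intros g b Hg Hb.
  - right. exists O. intros m _. simpl. apply (Cmod_qfin_le qq d Q); auto using prefix_lt.
  (* A mismatch at the head pays one factor [Q]; the rest is the induction hypothesis for [N]. *)
  - assert (Hhead : forall g b, inLam d g -> inLam d b -> b O <> g O ->
      (exists c M, forall m, (M <= m)%nat -> qfin qq (prefix m g) (prefix m b) = c) \/
      (exists M, forall m, (M <= m)%nat ->
         Cmod (qfin qq (prefix m g) (prefix m b)) <= Q ^ S N)).
    { clear g b Hg Hb. intros g b Hg Hb E0.
      destruct (classic (exists r, b r = g O)) as [[r Hr]|Hn].
      - destruct (first_at_exists _ _ _ Hr) as [r' Hf].
        pose proof (Cmod_qjw_prefix_lt qq d Q (g O) r' b HQ Hq (Hg O) Hb Hf E0) as Hle.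
        destruct (IHN (wtail g) (wdel r' b)) as [[c [M HM]]|[M HM]];
          auto using inLam_wtail, inLam_wdel.
        (* The prefix must contain position [r'] and still leave at least [M] letters. *)
        + left. exists (qjw qq (g O) (prefix r' b) * c)%C, (S (M + r')).
          intros [|m] Hm; [lia|].
          rewrite (qfin_prefix_step qq g b r'), HM by (auto; lia). reflexivity.
        + right. exists (S (M + r')). intros [|m] Hm; [lia|].
          rewrite (qfin_prefix_step qq g b r'), Cmod_mult by (auto; lia).
          assert (HM' : (M <= m)%nat) by lia. specialize (HM m HM').
          apply Rmult_le_compat; auto using Cmod_ge_0.
      - right. exists 1%nat. intros [|m] Hm; [lia|].
        rewrite qfin_prefix_absent, Cmod_0 by (intros r Hr; eauto).
        apply pow_le. lra. }
    destruct (classic (forall k, g k = b k)) as [E|E].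
    { left. exists (RtoC 1), O. intros m _.
      replace g with b by (apply functional_extensionality; auto). apply qfin_refl. }
    apply not_all_ex_not in E. destruct E as [k Hk].
    (* Here [k] is the position of some mismatch. Common first letters are stripped, at no cost,
       until a mismatch stands at the head. *)
    revert g b Hg Hb Hk. induction k as [|k IHk]; intros g b Hg Hb Hk;
      [apply Hhead; auto|].
    destruct (Nat.eq_dec (b O) (g O)) as [E0|E0]; [|auto].
    assert (Hf : first_at (g O) b O) by (split; [assumption|intros; lia]).
    assert (Hs : forall m, qfin qq (prefix (S m) g) (prefix (S m) b) =
                           qfin qq (prefix m (wtail g)) (prefix m (wtail b))).
    { intros m. rewrite (qfin_prefix_step qq g b O) by (auto; lia). apply Cmult_1_l. }
    destruct (IHk (wtail g) (wtail b)) as [[c [M HM]]|[M HM]]; auto using inLam_wtail.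
    + left. exists c, (S M). intros [|m] Hm; [lia|]. rewrite Hs. apply HM. lia.
    + right. exists (S M). intros [|m] Hm; [lia|]. rewrite Hs. apply HM. lia.
Qed.

(** * Complex limits and the kernel on infinite words *)

(** Asserts convergence, whereas [Clim] assigns a value to every sequence, including divergent
    ones. *)
Definition is_Clim (u : nat -> C) (l : C) : Prop :=
  is_lim_seq (fun n => fst (u n)) (fst l) /\ is_lim_seq (fun n => snd (u n)) (snd l).

Lemma is_Clim_unique u l : is_Clim u l -> Clim u = l.
Proof.
  intros [H1 H2]. unfold Clim.
  rewrite (is_lim_seq_unique _ _ H1), (is_lim_seq_unique _ _ H2).
  destruct l. reflexivity.
Qed.

Lemma is_Clim_const c : is_Clim (fun _ => c) c.
Proof.
  split; apply is_lim_seq_const.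
Qed.

Lemma is_Clim_plus u v l m : is_Clim u l -> is_Clim v m ->
  is_Clim (fun n => u n + v n)%C (l + m)%C.
Proof.
  intros [H1 H2] [H3 H4]. split; apply is_lim_seq_plus'; assumption.
Qed.

Lemma is_Clim_mult u v l m : is_Clim u l -> is_Clim v m ->
  is_Clim (fun n => u n * v n)%C (l * m)%C.
Proof.
  intros [H1 H2] [H3 H4]. split; simpl.
  - apply is_lim_seq_minus'; apply is_lim_seq_mult'; assumption.
  - apply is_lim_seq_plus'; apply is_lim_seq_mult'; assumption.
Qed.

Lemma is_Clim_ext_loc u v l M :
  (forall m, (M <= m)%nat -> u m = v m) -> is_Clim u l -> is_Clim v l.
Proof.
  intros H [H1 H2]. split.
  - apply is_lim_seq_ext_loc with (fun n => fst (u n)); [|assumption].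
    exists M. intros n Hn. rewrite H; auto.
  - apply is_lim_seq_ext_loc with (fun n => snd (u n)); [|assumption].
    exists M. intros n Hn. rewrite H; auto.
Qed.

Lemma is_Clim_incr u l : is_Clim u l <-> is_Clim (fun n => u (S n)) l.
Proof.
  unfold is_Clim.
  rewrite (is_lim_seq_incr_1 (fun n => fst (u n))), (is_lim_seq_incr_1 (fun n => snd (u n))).
  tauto.
Qed.

Lemma is_Clim_0 u :
  (forall eps, 0 < eps -> exists M, forall m, (M <= m)%nat -> Cmod (u m) < eps) ->
  is_Clim u (RtoC 0).
Proof.
  intros H. split; apply is_lim_seq_spec; intros eps;
    destruct (H eps (cond_pos eps)) as [M HM]; exists M; intros m Hm;
    specialize (HM m Hm); pose proof (Rmax_Cmod (u m)) as HR;
    simpl; rewrite Rminus_0_r.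
  - pose proof (Rmax_l (Rabs (fst (u m))) (Rabs (snd (u m)))). lra.
  - pose proof (Rmax_r (Rabs (fst (u m))) (Rabs (snd (u m)))). lra.
Qed.

Lemma is_Clim_Csum {A : Type} (f : nat -> A -> C) (g : A -> C) (l : list A) :
  (forall a, In a l -> is_Clim (fun n => f n a) (g a)) ->
  is_Clim (fun n => Csum (map (f n) l)) (Csum (map g l)).
Proof.
  induction l as [|a l IH]; intros H; simpl; [apply is_Clim_const|].
  apply is_Clim_plus; [apply H; left; reflexivity|].
  apply IH. intros b Hb. apply H. right. assumption.
Qed.

(** Either the sequence is eventually constant, or it is eventually below $Q^N$ for every $N$ and
    tends to 0. Hence [qinf] is a true limit. *)
Lemma qfin_prefix_cvg qq d Q g b : 0 <= Q < 1 -> q_bounded d qq Q ->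
  inLam d g -> inLam d b ->
  is_Clim (fun m => qfin qq (prefix m g) (prefix m b)) (qinf qq g b).
Proof.
  intros HQ Hq Hg Hb.
  assert (H : exists l, is_Clim (fun m => qfin qq (prefix m g) (prefix m b)) l).
  { assert (HQ' : 0 <= Q <= 1) by lra.
    pose proof (fun N => qfin_prefix_dichotomy qq d Q HQ' Hq N g b Hg Hb) as D.
    destruct (classic (exists c M, forall m, (M <= m)%nat ->
                         qfin qq (prefix m g) (prefix m b) = c)) as [[c [M HM]]|Hn].
    - exists c. apply is_Clim_ext_loc with (fun _ => c) M; [|apply is_Clim_const].
      intros m Hm. symmetry. auto.
    - exists (RtoC 0). apply is_Clim_0. intros eps Heps.
      destruct (pow_lt_1_zero Q) with (y := eps) as [N HN];
        [rewrite Rabs_pos_eq; lra|lra|].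
      destruct (D N) as [Hc|[M HM]]; [contradiction|].
      exists M. intros m Hm. eapply Rle_lt_trans; [apply HM, Hm|].
      specialize (HN N (le_n N)). apply Rabs_def2 in HN. lra. }
  destruct H as [l Hl]. unfold qinf. rewrite (is_Clim_unique _ _ Hl). exact Hl.
Qed.

Lemma qinf_refl qq b : qinf qq b b = RtoC 1.
Proof.
  apply is_Clim_unique.
  apply is_Clim_ext_loc with (fun _ => RtoC 1) O; [|apply is_Clim_const].
  intros m _. symmetry. apply qfin_refl.
Qed.

Lemma qinf_step qq d Q g b r : 0 <= Q < 1 -> q_bounded d qq Q ->
  inLam d g -> inLam d b -> first_at (g O) b r ->
  qinf qq g b = (qjw qq (g O) (prefix r b) * qinf qq (wtail g) (wdel r b))%C.
Proof.
  intros HQ Hq Hg Hb Hr. apply is_Clim_unique. apply is_Clim_incr.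
  apply is_Clim_ext_loc with
    (fun m => qjw qq (g O) (prefix r b) * qfin qq (prefix m (wtail g)) (prefix m (wdel r b)))%C r.
  - intros m Hm. symmetry. apply qfin_prefix_step; assumption.
  - apply is_Clim_mult; [apply is_Clim_const|].
    apply (qfin_prefix_cvg qq d Q); auto using inLam_wtail, inLam_wdel.
Qed.

Lemma qinf_absent qq g b : (forall r, b r <> g O) -> qinf qq g b = RtoC 0.
Proof.
  intros H. apply is_Clim_unique. apply is_Clim_incr.
  apply is_Clim_ext_loc with (fun _ => RtoC 0) O; [|apply is_Clim_const].
  intros m _. symmetry. apply qfin_prefix_absent, H.
Qed.

(** A vector involves finitely many words, so its form is the limit of the forms of its prefixes,
    which are nonnegative. *)
Lemma psd_qinf qq d Q : 0 <= Q < 1 -> q_bounded d qq Q -> q_hermitian d qq ->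
  psd (inLam d) (qinf qq).
Proof.
  intros HQ Hq Hh x Hx.
  assert (Hq1 : q_bounded d qq 1).
  { intros i j Hi Hj Hij. apply Rle_trans with Q; [apply Hq; auto|lra]. }
  assert (HL : is_Clim
    (fun m => qform (fun g b => qfin qq (prefix m g) (prefix m b)) x x)
    (qform (qinf qq) x x)).
  { unfold all_words in Hx. rewrite Forall_forall in Hx.
    unfold qform. apply is_Clim_Csum. intros p Hp. apply is_Clim_Csum. intros r Hr.
    apply is_Clim_mult; [apply is_Clim_const|].
    apply (qfin_prefix_cvg qq d Q); auto. }
  assert (HP : forall m,
    0 <= fst (qform (fun g b => qfin qq (prefix m g) (prefix m b)) x x) /\
    snd (qform (fun g b => qfin qq (prefix m g) (prefix m b)) x x) = 0).
  { intros m.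
    refine (psd_comap _ (inLam d) (prefix m) _ _ (psd_qfin qq d m Hq1 Hh) x Hx).
    intros w Hw. split; [unfold prefix; rewrite length_map, length_seq; reflexivity|].
    apply prefix_lt, Hw. }
  destruct HL as [H1 H2]. split.
  - assert (Rbar_le 0 (fst (qform (qinf qq) x x))); [|assumption].
    apply (is_lim_seq_le (fun _ => 0) _ 0 _ (fun n => proj1 (HP n)));
      [apply is_lim_seq_const|assumption].
  - apply (is_lim_seq_ext _ (fun _ => 0)) in H2; [|intros n; apply HP].
    apply is_lim_seq_unique in H2. rewrite Lim_seq_const in H2.
    injection H2. auto.
Qed.

(** * Intertwiners *)

Definition nrm (qq : nat -> nat -> C) (x : vec) : R := sqrt (nsq qq x).

Definition shiftv (j : nat) (x : vec) : vec :=
  map (fun p => (fst p, sigma_j j (snd p))) x.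

Definition basis (b : word) : vec := [(RtoC 1, b)].

Lemma ip_qform qq x y : ip qq x y = qform (qinf qq) x y.
Proof.
  reflexivity.
Qed.

Lemma ip_vsub_l qq x y z : ip qq (vsub x y) z = (ip qq x z - ip qq y z)%C.
Proof.
  unfold vsub. rewrite !ip_qform, qform_app_l, qform_scale_l. ring.
Qed.

Lemma ip_vsub_r qq x y z : ip qq x (vsub y z) = (ip qq x y - ip qq x z)%C.
Proof.
  unfold vsub. rewrite !ip_qform, qform_app_r, qform_scale_r.
  replace (Cconj (RtoC (-1))) with (RtoC (-1)).
  - ring.
  - apply injective_projections; simpl; ring.
Qed.

Lemma nsq_vsub_diag qq x : nsq qq (vsub x x) = 0.
Proof.
  unfold nsq. rewrite ip_vsub_l, ip_vsub_r. simpl. ring.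
Qed.

Lemma nsq_basis qq b : nsq qq (basis b) = 1.
Proof.
  unfold nsq, ip, basis, Csum. cbn [map fold_right fst snd].
  rewrite qinf_refl. simpl. ring.
Qed.

Lemma all_words_vsub (P : word -> Prop) x y :
  all_words P x -> all_words P y -> all_words P (vsub x y).
Proof.
  intros Hx Hy. apply all_words_app; [assumption|].
  apply (all_words_scale_by P (fun _ => RtoC (-1)) y Hy).
Qed.

Lemma Cmod_ip_le qq d x y : psd (inLam d) (qinf qq) ->
  all_words (inLam d) x -> all_words (inLam d) y ->
  Cmod (ip qq x y) <= nrm qq x * nrm qq y.
Proof.
  intros HK Hx Hy. pose proof (cauchy_schwarz _ _ x y HK Hx Hy) as H.
  destruct (HK x Hx) as [Px _]. destruct (HK y Hy) as [Py _].
  unfold nrm, nsq. rewrite !ip_qform, <- sqrt_mult by assumption.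
  rewrite <- (sqrt_pow2 (Cmod (qform (qinf qq) x y))) by apply Cmod_ge_0.
  apply sqrt_le_1_alt, H.
Qed.

(** The triangle inequality for $y=x-(x-y)$: expand the square and bound the mixed term by
    Cauchy-Schwarz. *)
Lemma nrm_vsub_le qq d x y : psd (inLam d) (qinf qq) ->
  all_words (inLam d) x -> all_words (inLam d) y ->
  nrm qq y <= nrm qq x + nrm qq (vsub x y).
Proof.
  intros HK Hx Hy.
  pose proof (all_words_vsub _ x y Hx Hy) as Hv.
  pose proof (Cmod_ip_le qq d x (vsub x y) HK Hx Hv) as H.
  pose proof (re_le_Cmod (ip qq x (vsub x y))) as Hr.
  pose proof (psd_hermitian _ _ x y HK Hx Hy) as Hh. rewrite <- !ip_qform in Hh.
  destruct (HK x Hx) as [Px _]. destruct (HK _ Hv) as [Pv _].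
  rewrite <- !ip_qform in *. change (0 <= nsq qq x) in Px.
  change (0 <= nsq qq (vsub x y)) in Pv.
  assert (E : nsq qq y = nsq qq x - 2 * Re (ip qq x (vsub x y)) + nsq qq (vsub x y)).
  { unfold nsq. rewrite ip_vsub_l, !ip_vsub_r, Hh. unfold Re. simpl. ring. }
  pose proof (sqrt_pos (nsq qq x)). pose proof (sqrt_pos (nsq qq (vsub x y))).
  apply Rle_trans with (sqrt ((nrm qq x + nrm qq (vsub x y)) ^ 2)).
  - apply sqrt_le_1_alt. rewrite E.
    assert (E1 : nrm qq x ^ 2 = nsq qq x) by (apply pow2_sqrt, Px).
    assert (E2 : nrm qq (vsub x y) ^ 2 = nsq qq (vsub x y)) by (apply pow2_sqrt, Pv).
    apply Rabs_le_between in Hr. nra.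
  - rewrite sqrt_pow2; [lra|]. unfold nrm. lra.
Qed.

(** * Shifts and their adjoints inside inner products *)

(** $s_j$ is an isometry: [j] heads both words, so its removal has coefficient 1. *)
Lemma nsq_shiftv qq d Q j x : 0 <= Q < 1 -> q_bounded d qq Q -> (j < d)%nat ->
  all_words (inLam d) x -> nsq qq (shiftv j x) = nsq qq x.
Proof.
  intros HQ Hq Hj Hx. unfold nsq, shiftv. rewrite !ip_qform, qform_map.
  f_equal. apply (qform_ext (inLam d)); auto. intros g b Hg Hb.
  assert (Hs : forall w, inLam d w -> inLam d (sigma_j j w)).
  { intros w Hw [|k]; simpl; auto. }
  rewrite (qinf_step qq d Q _ _ O); auto.
  - simpl. apply Cmult_1_l.
  - split; [reflexivity|intros; lia].
Qed.

Lemma ip_basis_shiftv qq b j y :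
  ip qq (basis b) (shiftv j y) =
  Csum (map (fun r => Cconj (fst r) * qinf qq (sigma_j j (snd r)) b)%C y).
Proof.
  unfold ip, basis, shiftv. simpl. rewrite map_map. simpl. rewrite Cplus_0_r.
  apply Csum_map_ext. intros r _. ring.
Qed.

(** This is $\langle e_b,s_jy\rangle=\langle s_j^*e_b,y\rangle$ with $s_j^*e_b=q(j,b)e_{b\setminus
    j}$. *)
Lemma ip_basis_shiftv_first qq d Q b j r y : 0 <= Q < 1 -> q_bounded d qq Q ->
  (j < d)%nat -> inLam d b -> all_words (inLam d) y -> first_at j b r ->
  ip qq (basis b) (shiftv j y) =
  (qjw qq j (prefix r b) * ip qq (basis (wdel r b)) y)%C.
Proof.
  intros HQ Hq Hj Hb Hy Hr. rewrite ip_basis_shiftv.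
  unfold ip, basis. simpl. rewrite Cplus_0_r, <- Csum_map_mult.
  apply Csum_map_ext. intros p Hp. unfold all_words in Hy.
  rewrite Forall_forall in Hy. specialize (Hy p Hp).
  rewrite (qinf_step qq d Q (sigma_j j (snd p)) b r); auto.
  - change (wtail (sigma_j j (snd p))) with (snd p). simpl. ring.
  - intros [|k]; simpl; auto.
Qed.

Lemma ip_basis_shiftv_absent qq b j y : (forall r, b r <> j) ->
  ip qq (basis b) (shiftv j y) = RtoC 0.
Proof.
  intros H. rewrite ip_basis_shiftv. apply Csum_map_zero. intros p _.
  rewrite qinf_absent by assumption. ring.
Qed.

Lemma word_equiv_sym b a : word_equiv b a -> word_equiv a b.
Proof.
  intros [m [n H]]. exists n, m. intros k. symmetry. apply H.
Qed.

Lemma word_equiv_trans a b c : word_equiv a b -> word_equiv b c -> word_equiv a c.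
Proof.
  intros [m [n H]] [m' [n' H']]. exists (m + m')%nat, (n' + n)%nat. intros k.
  rewrite <- Nat.add_assoc, H.
  replace (n + (m' + k))%nat with (m' + (n + k))%nat by lia.
  rewrite H'. f_equal. lia.
Qed.

Lemma word_equiv_wdel r b : word_equiv b (wdel r b).
Proof.
  exists (S r), r. intros k. unfold wdel.
  destruct (Nat.ltb_spec (r + k) r); [lia|]. reflexivity.
Qed.

Lemma vec_in_inLam d a x : vec_in d a x -> all_words (inLam d) x.
Proof.
  apply Forall_impl. tauto.
Qed.

(* [limsup f <= D] *)
Definition evle (f : nat -> R) (D : R) : Prop :=
  forall eps, 0 < eps -> exists n0, forall n, (n0 <= n)%nat -> f n <= D + eps.

Lemma evle_le f D D' : D <= D' -> evle f D -> evle f D'.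
Proof.
  intros H Hf eps He. destruct (Hf eps He) as [n0 Hn]. exists n0.
  intros n Hn0. specialize (Hn n Hn0). lra.
Qed.

Lemma evle_mono f g D : (forall n, f n <= g n) -> evle g D -> evle f D.
Proof.
  intros H Hf eps He. destruct (Hf eps He) as [n0 Hn]. exists n0.
  intros n Hn0. specialize (Hn n Hn0). specialize (H n). lra.
Qed.

Lemma evle_plus f g D E : evle f D -> evle g E -> evle (fun n => f n + g n) (D + E).
Proof.
  intros Hf Hg eps He. destruct (Hf (eps / 2)) as [n0 Hn]; [lra|].
  destruct (Hg (eps / 2)) as [n1 Hn1]; [lra|]. exists (n0 + n1)%nat.
  intros n Hn'. specialize (Hn n ltac:(lia)). specialize (Hn1 n ltac:(lia)). lra.
Qed.

Lemma evle_mult c f D : 0 <= c -> evle f D -> evle (fun n => c * f n) (c * D).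
Proof.
  intros Hc Hf eps He. destruct (Hf (eps / (c + 1))) as [n0 Hn].
  { apply Rdiv_lt_0_compat; lra. }
  exists n0. intros n Hn0. specialize (Hn n Hn0).
  assert (E : (c + 1) * (eps / (c + 1)) = eps) by (field; lra).
  assert (0 < eps / (c + 1)) by (apply Rdiv_lt_0_compat; lra). nra.
Qed.

Lemma evle_nrm_vsub qq (u v : nat -> vec) :
  eqH qq u v -> evle (fun n => nrm qq (vsub (u n) (v n))) 0.
Proof.
  intros H eps He. apply is_lim_seq_spec in H.
  destruct (H (mkposreal (eps ^ 2) (pow_lt _ 2 He))) as [n0 Hn]. simpl in Hn.
  exists n0. intros n Hn0. specialize (Hn n Hn0). rewrite Rminus_0_r in Hn.
  apply Rabs_def2 in Hn. unfold nrm.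
  apply Rle_trans with (sqrt (eps ^ 2)); [|rewrite sqrt_pow2; lra].
  apply sqrt_le_1_alt. simpl. lra.
Qed.

(* [v 0] lies in the ranges of all
   [s_(a 0) ... s_(a k)]. *)
Definition chain (d : nat) (qq : nat -> nat -> C) (a : word) (B : R)
    (v : nat -> nat -> vec) : Prop :=
  (forall k n, all_words (inLam d) (v k n)) /\
  (forall k, eqH qq (v k) (fun n => shiftv (a k) (v (S k) n))) /\
  (forall k, evle (fun n => nrm qq (v k n)) B).

(** The two vectors differ by a null sequence and $e_b$ is a unit vector, so Cauchy-Schwarz makes
    the difference of the inner products vanish in the limit. *)
Lemma chain_shift_bound qq d Q a B v k b D :
  0 <= Q < 1 -> q_bounded d qq Q -> q_hermitian d qq -> inLam d a ->
  chain d qq a B v -> inLam d b ->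
  evle (fun n => Cmod (ip qq (basis b) (shiftv (a k) (v (S k) n)))) D ->
  evle (fun n => Cmod (ip qq (basis b) (v k n))) D.
Proof.
  intros HQ Hq Hh Ha [Hv [Hs _]] Hb HD.
  pose proof (psd_qinf qq d Q HQ Hq Hh) as HK.
  assert (Hsh : forall n, all_words (inLam d) (shiftv (a k) (v (S k) n))).
  { intros n. apply all_words_map with (inLam d); [|apply Hv].
    intros w Hw [|i]; simpl; auto. }
  assert (Hbb : all_words (inLam d) (basis b)) by (constructor; auto).
  apply evle_le with (D + 0); [lra|].
  apply evle_mono with
    (fun n => Cmod (ip qq (basis b) (shiftv (a k) (v (S k) n))) +
              nrm qq (vsub (v k n) (shiftv (a k) (v (S k) n)))).
  2:{ apply evle_plus; [assumption|]. apply evle_nrm_vsub, Hs. }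
  intros n.
  replace (ip qq (basis b) (v k n)) with
    (ip qq (basis b) (shiftv (a k) (v (S k) n)) +
     ip qq (basis b) (vsub (v k n) (shiftv (a k) (v (S k) n))))%C
    by (rewrite ip_vsub_r; ring).
  eapply Rle_trans; [apply Cmod_triangle|]. apply Rplus_le_compat_l.
  eapply Rle_trans.
  - apply (Cmod_ip_le qq d); auto using all_words_vsub.
  - unfold nrm at 1. rewrite nsq_basis, sqrt_1. lra.
Qed.

(** Adjoint shifts move from the chain to $e_b$. Each letter of [a] that is not the current first
    letter of [b] gains a factor [Q], or gives 0 if it is absent; non-equivalence supplies such
    mismatches again and again. *)
Lemma chain_basis_bound qq d Q a B v :
  0 <= Q < 1 -> q_bounded d qq Q -> q_hermitian d qq -> inLam d a -> 0 <= B ->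
  chain d qq a B v ->
  forall N k b, inLam d b -> ~ word_equiv b a ->
  evle (fun n => Cmod (ip qq (basis b) (v k n))) (Q ^ N * B).
Proof.
  intros HQ Hq Hh Ha HB Hc.
  pose proof (psd_qinf qq d Q HQ Hq Hh) as HK.
  induction N as [|N IHN]; intros k b Hb Hab.
  - apply evle_le with B; [simpl; lra|].
    apply evle_mono with (fun n => nrm qq (v k n)); [|apply Hc].
    intros n. eapply Rle_trans; [apply (Cmod_ip_le qq d); auto|].
    + constructor; auto.
    + apply Hc.
    + unfold nrm at 1. rewrite nsq_basis, sqrt_1. lra.
  - assert (Hstep : forall k b r D, inLam d b -> first_at (a k) b r ->
      evle (fun n => Cmod (ip qq (basis (wdel r b)) (v (S k) n))) D ->
      evle (fun n => Cmod (ip qq (basis b) (v k n)))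
           (Cmod (qjw qq (a k) (prefix r b)) * D)).
    { clear k b Hb Hab. intros k b r D Hb Hr HD.
      apply (chain_shift_bound qq d Q a B); auto.
      apply evle_mono with (fun n => Cmod (qjw qq (a k) (prefix r b)) *
                              Cmod (ip qq (basis (wdel r b)) (v (S k) n))).
      - intros n. rewrite (ip_basis_shiftv_first qq d Q b (a k) r), Cmod_mult; auto; [lra|].
        apply Hc.
      - apply evle_mult; [apply Cmod_ge_0|assumption]. }
    (* Deleting a letter keeps the tail class, so the induction hypothesis stays applicable. *)
    assert (Hdel : forall r b, ~ word_equiv b a -> ~ word_equiv (wdel r b) a).
    { intros r w Hw H. apply Hw. eapply word_equiv_trans; [apply word_equiv_wdel|exact H]. }
    assert (Hhead : forall k b, inLam d b -> ~ word_equiv b a -> b O <> a k ->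
      evle (fun n => Cmod (ip qq (basis b) (v k n))) (Q ^ S N * B)).
    { clear k b Hb Hab. intros k b Hb Hab E0.
      destruct (classic (exists r, b r = a k)) as [[r0 Hr0]|Hn].
      - destruct (first_at_exists _ _ _ Hr0) as [r Hr].
        pose proof (Cmod_qjw_prefix_lt qq d Q (a k) r b ltac:(lra) Hq (Ha k) Hb Hr E0) as Hle.
        eapply evle_le; [|apply (Hstep k b r (Q ^ N * B)); auto using inLam_wdel].
        simpl. rewrite Rmult_assoc. apply Rmult_le_compat_r; [|assumption].
        apply Rmult_le_pos; [apply pow_le; lra|assumption].
      - apply (chain_shift_bound qq d Q a B); auto.
        apply evle_mono with (fun _ => 0).
        + intros n. rewrite ip_basis_shiftv_absent, Cmod_0 by (intros r Hr; eauto). lra.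
        + intros eps He. exists O. intros n _.
          pose proof (Rmult_le_pos (Q ^ S N) B ltac:(apply pow_le; lra) HB). lra. }
    (* Without a mismatch [b] would be a tail of [a]. *)
    assert (Hi : exists i, a (k + i)%nat <> b i).
    { apply not_all_ex_not. intros H. apply Hab. exists O, k. intros i. symmetry. apply H. }
    (* Matching first letters are removed with coefficient 1 until a mismatch reaches the head. *)
    destruct Hi as [i Hi]. revert k b Hb Hab Hi.
    induction i as [|i IHi]; intros k b Hb Hab Hi.
    + rewrite Nat.add_0_r in Hi. auto.
    + destruct (Nat.eq_dec (b O) (a k)) as [E0|E0]; [|auto].
      assert (Hf : first_at (a k) b O) by (split; [assumption|intros; lia]).
      eapply evle_le; [|apply (Hstep k b O (Q ^ S N * B)); auto].
      * simpl qjw. rewrite Cmod_1. lra.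
      * change (wdel 0 b) with (wtail b). apply IHi.
        -- apply inLam_wtail, Hb.
        -- exact (Hdel O b Hab).
        -- unfold wtail. replace (S k + i)%nat with (k + S i)%nat by lia. assumption.
Qed.

(** Let [N] grow in the bound $Q^N B$ for basis vectors, then extend by linearity in [x]. *)
Lemma chain_orthogonal qq d Q a B v x :
  0 <= Q < 1 -> q_bounded d qq Q -> q_hermitian d qq -> inLam d a -> 0 <= B ->
  chain d qq a B v ->
  all_words (fun b => inLam d b /\ ~ word_equiv b a) x ->
  evle (fun n => Cmod (ip qq x (v O n))) 0.
Proof.
  intros HQ Hq Hh Ha HB Hc Hx. induction Hx as [|[c b] x [Hb Hab] Hx IH].
  - intros eps He. exists O. intros n _. unfold ip. simpl. rewrite Cmod_0. lra.
  - simpl in Hb, Hab.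
    assert (Hz : evle (fun n => Cmod (ip qq (basis b) (v O n))) 0).
    { intros eps He.
      (* [N] is such that $Q^N(B+1)<\varepsilon/2$; [B + 1] avoids a division by zero. *)
      destruct (pow_lt_1_zero Q) with (y := eps / 2 / (B + 1)) as [N HN].
      - rewrite Rabs_pos_eq; lra.
      - apply Rdiv_lt_0_compat; lra.
      - specialize (HN N (le_n N)). rewrite Rabs_pos_eq in HN by (apply pow_le; lra).
        destruct (chain_basis_bound qq d Q a B v HQ Hq Hh Ha HB Hc N O b Hb Hab (eps / 2))
          as [n0 Hn]; [lra|].
        exists n0. intros n Hn0. specialize (Hn n Hn0).
        assert (E : eps / 2 / (B + 1) * (B + 1) = eps / 2) by (field; lra).
        pose proof (pow_le Q N (proj1 HQ)). nra. }
    apply evle_le with (Cmod c * 0 + 0); [lra|].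
    apply evle_mono with
      (fun n => Cmod c * Cmod (ip qq (basis b) (v O n)) + Cmod (ip qq x (v O n))).
    + intros n. rewrite <- Cmod_mult.
      replace (ip qq ((c, b) :: x) (v O n)) with
        (c * ip qq (basis b) (v O n) + ip qq x (v O n))%C; [apply Cmod_triangle|].
      change ((c, b) :: x) with ([(c, b)] ++ x).
      rewrite (ip_qform qq ([(c, b)] ++ x)), qform_app_l.
      replace [(c, b)] with (vscale c (basis b)).
      * rewrite qform_scale_l. reflexivity.
      * unfold vscale, basis. simpl. rewrite Cmult_1_r. reflexivity.
    + apply evle_plus; [|assumption]. apply evle_mult; [apply Cmod_ge_0|assumption].
Qed.

(** Each $v_n$ of the sequence [v O] is a combination of words equivalent to [a'], hence
    asymptotically orthogonal to the sequence itself. In $\|v_n\|^2=\langle v_n,v_m\rangle+\langle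
    v_n,v_n-v_m\rangle$ the first term is small for large $m$, and the second by the Cauchy
    property. *)
Lemma chain_null qq d Q a a' B v :
  0 <= Q < 1 -> q_bounded d qq Q -> q_hermitian d qq -> inLam d a -> 0 <= B ->
  ~ word_equiv a a' -> chain d qq a B v -> isH d qq a' (v O) ->
  is_lim_seq (fun n => nsq qq (v O n)) 0.
Proof.
  intros HQ Hq Hh Ha HB Hne Hc [Hin Hcau].
  pose proof (psd_qinf qq d Q HQ Hq Hh) as HK.
  apply is_lim_seq_spec. intros [eps He]. simpl.
  destruct Hc as [Hv Hc']. assert (Hc := conj Hv Hc').
  destruct (proj2 Hc' O 1) as [n1 Hn1]; [lra|].
  set (del := eps / 2 / (B + 1)).
  assert (Hdel : 0 < del) by (apply Rdiv_lt_0_compat; lra).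
  destruct (Hcau (del ^ 2)) as [n2 Hn2]; [apply pow_lt, Hdel|].
  exists (n1 + n2)%nat. intros n Hn. rewrite Rminus_0_r.
  specialize (Hn1 n ltac:(lia)).
  destruct (HK _ (Hv O n)) as [Pn _]. change (0 <= nsq qq (v O n)) in Pn.
  rewrite Rabs_pos_eq by assumption.
  destruct (chain_orthogonal qq d Q a B v (v O n) HQ Hq Hh Ha HB Hc) with (eps := eps / 4)
    as [n3 Hn3]; [|lra|].
  { eapply Forall_impl; [|exact (Hin n)]. intros p [Hp Hp']. split; [assumption|].
    intros H. apply Hne. eapply word_equiv_trans; [apply word_equiv_sym, H|exact Hp']. }
  (* [m] comes after [n], because [n3] depends on the vector [v O n]. *)
  set (m := (n2 + n3)%nat). specialize (Hn3 m ltac:(lia)).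
  specialize (Hn2 n m ltac:(lia) ltac:(lia)).
  pose proof (all_words_vsub _ _ _ (Hv O n) (Hv O m)) as Hnm.
  pose proof (Cmod_ip_le qq d (v O n) _ HK (Hv O n) Hnm) as Hcs.
  assert (Hd : nrm qq (vsub (v O n) (v O m)) <= del).
  { unfold nrm. apply Rle_trans with (sqrt (del ^ 2)); [|rewrite sqrt_pow2; lra].
    apply sqrt_le_1_alt. lra. }
  assert (E : ip qq (v O n) (v O n) =
     (ip qq (v O n) (v O m) + ip qq (v O n) (vsub (v O n) (v O m)))%C)
    by (rewrite ip_vsub_r; ring).
  assert (Hle : nsq qq (v O n) <= Cmod (ip qq (v O n) (v O n))).
  { eapply Rle_trans; [|apply re_le_Cmod]. apply Rle_abs. }
  rewrite E in Hle.
  pose proof (Cmod_triangle (ip qq (v O n) (v O m)) (ip qq (v O n) (vsub (v O n) (v O m)))).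
  assert (Hprod : nrm qq (v O n) * nrm qq (vsub (v O n) (v O m)) <= (B + 1) * del).
  { apply Rmult_le_compat; try apply sqrt_pos; assumption. }
  assert (Ed : (B + 1) * del = eps / 2) by (unfold del; field; lra).
  lra.
Qed.

(** * A uniform bound on the $q_{ij}$, and elements of the completion *)

Lemma bound_below_one (f : nat -> R) n :
  (forall i, (i < n)%nat -> f i < 1) ->
  exists Q, 0 <= Q < 1 /\ forall i, (i < n)%nat -> f i <= Q.
Proof.
  induction n as [|n IH]; intros H.
  - exists 0. split; [lra|]. intros; lia.
  - destruct IH as [Q [HQ HQ']]; [intros; apply H; lia|].
    exists (Rmax Q (f n)). pose proof (Rmax_l Q (f n)). pose proof (Rmax_r Q (f n)).
    split.
    + split; [lra|]. apply Rmax_lub_lt; [lra|]. apply H. lia.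
    + intros i Hi. destruct (Nat.eq_dec i n) as [->|Hin]; [assumption|].
      specialize (HQ' i ltac:(lia)). lra.
Qed.

Lemma q_bounded_exists d qq :
  (forall i j, (i < d)%nat -> (j < d)%nat -> i <> j -> Cmod (qq i j) < 1) ->
  exists Q, 0 <= Q < 1 /\ q_bounded d qq Q.
Proof.
  intros H.
  (* The pair $(i,j)$ is coded as $di+j$; diagonal pairs get the value 0. *)
  destruct (bound_below_one (fun k => let (i, j) := (k / d, k mod d)%nat in
              if Nat.eqb i j then 0 else Cmod (qq i j)) (d * d)) as [Q [HQ HQ']].
  - intros k Hk. simpl.
    destruct (Nat.eqb_spec (k / d) (k mod d)); [lra|]. apply H; auto.
    + apply Nat.Div0.div_lt_upper_bound. assumption.
    + apply Nat.mod_upper_bound. lia.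
  - exists Q. split; [assumption|]. intros i j Hi Hj Hij.
    specialize (HQ' (d * i + j)%nat ltac:(nia)). simpl in HQ'.
    rewrite (Nat.mul_comm d i), Nat.div_add_l, (Nat.div_small j d), Nat.add_0_r in HQ' by lia.
    rewrite Nat.add_comm, Nat.Div0.mod_add, Nat.mod_small in HQ' by lia.
    destruct (Nat.eqb_spec i j); [contradiction|assumption].
Qed.

Lemma eqH_refl qq u : eqH qq u u.
Proof.
  apply is_lim_seq_ext with (fun _ => 0); [|apply is_lim_seq_const].
  intros n. symmetry. apply nsq_vsub_diag.
Qed.

Lemma isH_equiv d qq a a' u : word_equiv a a' -> isH d qq a u -> isH d qq a' u.
Proof.
  intros H [H1 H2]. split; [|assumption]. intros n.
  eapply Forall_impl; [|exact (H1 n)]. intros p [Hp Hp'].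
  split; [assumption|]. eapply word_equiv_trans; eassumption.
Qed.

Lemma isH_const d qq a b : inLam d b -> word_equiv b a -> isH d qq a (fun _ => basis b).
Proof.
  intros Hb Hba. split.
  - intros _. constructor; [split; assumption|constructor].
  - intros eps He. exists O. intros. rewrite nsq_vsub_diag. assumption.
Qed.

Theorem mainTheorem5 (d : nat) (qq : nat -> nat -> C)
  (hd : (2 <= d)%nat)
  (hqabs : forall i j, (i < d)%nat -> (j < d)%nat -> i <> j -> Cmod (qq i j) < 1)
  (hqconj : forall i j, (i < d)%nat -> (j < d)%nat -> i <> j -> qq i j = Cconj (qq j i))
  (a a' : word) (ha : inLam d a) (ha' : inLam d a') :
  unit_equiv d qq a a' <-> word_equiv a a'.
Proof.
  split.
  - intros [U [HU1 [_ [_ [HU4 [_ HU6]]]]]]. apply NNPP. intros Hne.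
    destruct (q_bounded_exists d qq hqabs) as [Q [HQ Hq]].
    pose proof (psd_qinf qq d Q HQ Hq hqconj) as HK.
    (* [e k] is $e_{\sigma^k(a)}$ as a constant sequence. *)
    set (e := fun k (_ : nat) => basis (fun i => a (k + i)%nat)).
    assert (He : forall k, isH d qq a (e k)).
    { intros k. apply isH_const; [intros i; apply ha|]. exists O, k. reflexivity. }
    set (v := fun k => U (e k)).
    assert (Hv : forall k n, all_words (inLam d) (v k n)).
    { intros k n. apply (vec_in_inLam d a'), HU1, He. }
    assert (Hs : forall k, eqH qq (v k) (fun n => shiftv (a k) (v (S k) n))).
    { intros k.
      (* $s_{a_k}e_{\sigma^{k+1}(a)}=e_{\sigma^k(a)}$ is an equality of sequences, so only the
         intertwining relation is needed. *)
      replace (v k) with (U (shiftH (a k) (e (S k)))); [apply HU6; auto|].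
      unfold v. f_equal. unfold shiftH, e, basis. simpl.
      apply functional_extensionality. intros _. do 2 f_equal.
      apply functional_extensionality. intros [|i]; simpl; f_equal; lia. }
    destruct (HU1 _ (He O)) as [_ Hcau]. fold (v O) in Hcau.
    destruct (Hcau 1) as [n0 Hn0]; [lra|].
    (* From [n0] on, the Cauchy sequence [v O] stays within 1 of [v O n0]. *)
    set (B := nrm qq (v O n0) + 1).
    assert (HB : 0 <= B).
    { pose proof (sqrt_pos (nsq qq (v O n0))). unfold B, nrm. lra. }
    assert (Hbd : forall k, evle (fun n => nrm qq (v k n)) B).
    { induction k as [|k IHk].
      - intros eps Heps. exists n0. intros n Hn.
        pose proof (nrm_vsub_le qq d (v O n0) (v O n) HK (Hv O n0) (Hv O n)) as Ht.
        specialize (Hn0 n0 n (le_n _) Hn).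
        assert (nrm qq (vsub (v O n0) (v O n)) <= 1); [|unfold B; lra].
        rewrite <- sqrt_1. apply sqrt_le_1_alt. lra.
      (* The bound passes from [k] to [S k] because the shift is isometric and the error is a null
         sequence. *)
      - apply evle_le with (B + 0); [lra|].
        eapply evle_mono; [|exact (evle_plus _ _ _ _ IHk (evle_nrm_vsub _ _ _ (Hs k)))].
        intros n. simpl.
        replace (nrm qq (v (S k) n)) with (nrm qq (shiftv (a k) (v (S k) n))).
        + apply (nrm_vsub_le qq d); auto.
          apply all_words_map with (inLam d); [|auto].
          intros w Hw [|i]; simpl; auto.
        + unfold nrm. rewrite (nsq_shiftv qq d Q); auto. }
    assert (Hlim : is_lim_seq (fun n => nsq qq (v O n)) 0).
    { apply (chain_null qq d Q a a' B); auto.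
      - exact (conj Hv (conj Hs Hbd)).
      - apply HU1, He. }
    (* The contradiction: $Ue_a$ has norm 0, while $U$ preserves inner products and $e_a$ has norm
       1. *)
    assert (E0 : fst (ipH qq (v O) (v O)) = 0).
    { exact (f_equal real (is_lim_seq_unique _ _ Hlim)). }
    assert (E1 : fst (ipH qq (e O) (e O)) = 1).
    { transitivity (real (Lim_seq (fun _ => nsq qq (e O O)))); [reflexivity|].
      rewrite Lim_seq_const. apply nsq_basis. }
    unfold v in E0. rewrite HU4 in E0 by apply He. lra.
  (* Equivalent words have the same tail class, so both spaces consist of the same sequences and the
     identity intertwines. *)
  - intros H. exists (fun u => u). repeat split.
    + apply (isH_equiv d qq a a' u H H0).
    + apply (isH_equiv d qq a a' u H H0).
    + auto.
    + intros. apply eqH_refl.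
    + intros v Hv. exists v. split; [|apply eqH_refl].
      apply (isH_equiv d qq a' a); [apply word_equiv_sym|]; assumption.
    + intros. apply eqH_refl.
Qed.
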